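(* Let $n\ge 3$ be an integer. Then the bipartite Kneser graph $H(n,1)$ is distance-transitive.
   Context: Let $[n]=\{1,2,\dots,n\}$. For $n\ge 3$, the bipartite Kneser graph $H(n,1)$ is the simple graph whose vertices are all the $1$-element subsets and all the $(n-1)$-element subsets of $[n]$, two distinct vertices $A,B$ being adjacent if and only if $A\subset B$ or $B\subset A$. A graph $\Gamma$ is distance-transitive if for all vertices $u,v,x,y$ of $\Gamma$ with $d(u,v)=d(x,y)$, where $d$ denotes the distance in $\Gamma$, there is an automorphism $\pi\in\mathrm{Aut}(\Gamma)$ with $\pi(u)=x$ and $\pi(v)=y$. *)

(* Defs.v *)
From HB Require Import structures.
From mathcomp Require Import all_boot all_order all_fingroup.

Set Implicit Arguments.
Unset Strict Implicit.
Unset Printing Implicit Defensive.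

Record sgraph := SGraph {
  vertex :> finType;
  adj : rel vertex;
  adj_sym : symmetric adj;
  adj_irrefl : irreflexive adj
}.

Section Distance.
Variable G : sgraph.
Implicit Types u v : G.

Definition walk u v (k : nat) : bool :=
  [exists p : k.-tuple G, path (@adj G) u p && (last u p == v)].

Lemma connect_walk u v : connect (@adj G) u v -> exists k, walk u v k.
Proof.
case/connectP=> p up vE; exists (size p); apply/existsP; exists (in_tuple p).
by rewrite up vE eqxx.
Qed.

(* [None] stands for infinite distance: no walk joins [u] to [v]. *)
Definition dist u v : option nat :=
  if @idP (connect (@adj G) u v) is ReflectT uv
  then Some (ex_minn (connect_walk uv)) else None.

Definition graph_aut : {set {perm G}} :=
  [set p : {perm G} | [forall x, forall y, adj (p x) (p y) == adj x y]].

End Distance.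

Definition distance_transitive (G : sgraph) : Prop :=
  forall u v x y : G, dist u v = dist x y ->
  exists2 p : {perm G}, p \in graph_aut G & p u = x /\ p v = y.

Section BipartiteKneser.
Variables n k : nat.

(* The ground set [n] is represented by 'I_n = {0, ..., n-1}. *)
Definition bkneser_vertex : finType :=
  {A : {set 'I_n} | (#|A| == k) || (#|A| == n - k)}.

Definition bkneser_adj : rel bkneser_vertex := fun A B =>
  (A != B) && ((val A \subset val B) || (val B \subset val A)).

Lemma bkneser_adj_sym : symmetric bkneser_adj.
Proof. by move=> A B; rewrite /bkneser_adj eq_sym orbC. Qed.

Lemma bkneser_adj_irrefl : irreflexive bkneser_adj.
Proof. by move=> A; rewrite /bkneser_adj eqxx. Qed.

Definition bipartite_kneser : sgraph :=
  SGraph bkneser_adj_sym bkneser_adj_irrefl.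

End BipartiteKneser.

(* Main.v *)
Require Import Defs.
From mathcomp Require Import all_boot all_order all_fingroup.

(** With [A_i = {i}] and [B_i] its complement, the graph [H(n,1)] is the crown
graph: the bipartite graph with sides [{A_i}] and [{B_i}] in which [A_i] and
[B_j] are adjacent exactly when [i <> j] ([knode_adj]).  For [n >= 3] the sizes
[1] and [n - 1] are different, so these are [2 n] distinct vertices
([knode_bij]).  A pair of vertices is thus described by two
bits: are they on the same side, and do they have the same index?

The distance of a pair determines both bits ([dist_knode]).  Two vertices are
joined by a walk of length 2 iff they are on the same side, because two indices
always leave a third one free; hence the distance is 0, 1 or 2 for the types
(same, same), (different, different), (same, different), and it is none of
these for the remaining type.  The actual distance 3 of the remaining type
is therefore never computed.

Conversely the automorphisms are transitive on the pairs of each type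
([pair_move]): a permutation of the ground set moves the indices at will
([perm_move2]), and complementation exchanges the sides. *)

Set Implicit Arguments.
Unset Strict Implicit.
Unset Printing Implicit Defensive.

(** * Walks and distance in a graph *)

Section Walks.
Variable G : sgraph.
Implicit Types u v : G.

Lemma walk0 u v : walk u v 0 = (u == v).
Proof.
apply/existsP/idP => [[p]|uv]; first by rewrite tuple0.
by exists [tuple].
Qed.

Lemma walkS u v k : walk u v k.+1 = [exists w, adj u w && walk w v k].
Proof.
apply/existsP/existsP => [[p]|[w /andP[uw /existsP[p /andP[wp pv]]]]].
  case/tupleP: p => w p /= /andP[/andP[uw wp] pv].
  by exists w; rewrite uw; apply/existsP; exists p; rewrite wp.
by exists [tuple of w :: p]; rewrite /= uw wp.
Qed.

Lemma walk1 u v : walk u v 1 = adj u v.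
Proof.
rewrite walkS; apply/existsP/idP => [[w]|uv].
  by rewrite walk0 => /andP[uw /eqP <-].
by exists v; rewrite uv walk0 eqxx.
Qed.

Lemma walk_connect u v k : walk u v k -> connect (@adj G) u v.
Proof.
by case/existsP=> p /andP[up /eqP pv]; apply/connectP; exists p.
Qed.

(** Describes the distance by walks alone, which hides the proof of
connectedness on which [dist] is defined by cases. *)
Lemma dist_eq_some u v k :
  (dist u v == Some k) = walk u v k && [forall j : 'I_k, ~~ walk u v j].
Proof.
rewrite /dist; case: {-}_ / idP => [uv|nuv]; last first.
  by apply/esym/negP => /andP[/walk_connect].
case: ex_minnP => m wm minm; apply/eqP/andP => [[<-]|[wk /forallP nwk]].
  split=> //; apply/forallP => j; apply/negP => /minm.
  by rewrite leqNgt ltn_ord.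
have := minm _ wk; rewrite leq_eqVlt => /predU1P[-> //|lt_mk].
by have := nwk (Ordinal lt_mk); rewrite wm.
Qed.

End Walks.

(** * Moving two points by a permutation *)

Lemma perm_move2 (T : finType) (i j i' j' : T) :
  (i == j) = (i' == j') -> exists2 s : {perm T}, s i = i' & s j = j'.
Proof.
move=> eq_ij.
(* The first transposition sends i to i'; the second one corrects the image of
   j and leaves i' alone. *)
exists (tperm i i' * tperm (tperm i i' j) j')%g; rewrite permM tpermL //.
have [ij|nij] := eqVneq i j.
  by move: eq_ij; rewrite -ij eqxx => /esym/eqP <-; rewrite tpermL tperm1 perm1.
rewrite tpermD //; last by rewrite eq_sym -eq_ij.
by rewrite -[X in _ != X](tpermL i i') inj_eq ?(eq_sym j) //; apply: perm_inj.
Qed.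

(** * The crown structure of H(n,1) *)

Section Crown.
Variable n : nat.
Hypothesis n_ge3 : 3 <= n.
Local Notation H := (bipartite_kneser n 1).

Lemma knode_subproof (p : bool * 'I_n) :
  let A := if p.1 then ~: [set p.2] else [set p.2] in
  (#|A| == 1) || (#|A| == n - 1).
Proof.
case: p => -[] i /=; last by rewrite cards1.
by rewrite cardsC1 card_ord subn1 eqxx orbT.
Qed.

(** Coordinates on the crown: the bit is the side, the ordinal is the index; a
vertex of size [n - 1] is indexed by the one point that it omits. *)
Definition knode (p : bool * 'I_n) : H :=
  exist _ (if p.1 then ~: [set p.2] else [set p.2]) (knode_subproof p).

Lemma setC1_neq_set1 (i j : 'I_n) : ~: [set i] != [set j].
Proof.
apply/negP => /eqP/(congr1 (fun A : {set 'I_n} => #|A|)).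
by rewrite cardsC1 cards1 card_ord; move: n_ge3; case: n => [|[|[]]].
Qed.

Lemma knode_inj : injective knode.
Proof.
move=> [b i] [c j] /(congr1 val); case: b c => -[] /=.
- by move=> /setC_inj/set1_inj ->.
- by move=> E; case/eqP: (setC1_neq_set1 i j).
- by move=> E; case/eqP: (setC1_neq_set1 j i).
- by move=> /set1_inj ->.
Qed.

Lemma knode_surj (u : H) : exists p, knode p == u.
Proof.
case: u => A cA; case/orP: (cA) => [/cards1P[i Ai]|/eqP cAn].
  by exists (false, i); rewrite -val_eqE /= Ai.
have /cards1P[i Ai] : #|~: A| == 1.
  by rewrite cardsCs setCK card_ord cAn subKn // ltnW // ltnW.
by exists (true, i); rewrite -val_eqE /= -Ai setCK.
Qed.

Lemma knode_bij : bijective knode.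
Proof.
have xK : cancel (fun u => xchoose (knode_surj u)) knode.
  by move=> u; apply/eqP/(xchooseP (knode_surj u)).
by exists (fun u => xchoose (knode_surj u)) => // p; apply: knode_inj; rewrite xK.
Qed.

(** [{i}] lies in the complement of [{j}] iff [i] differs from [j]; the opposite
inclusion would force [n - 1 <= 1], and sets of equal size contain each other
only when they are equal. *)
Lemma knode_adj b c (i j : 'I_n) :
  adj (knode (b, i)) (knode (c, j)) = (b != c) && (i != j).
Proof.
have C1sub1 (k l : 'I_n) : ~: [set k] \subset [set l] = false.
  apply/negP => /subset_leq_card.
  by rewrite cardsC1 cards1 card_ord; move: n_ge3; case: n => [|[|[]]].
rewrite /= /bkneser_adj (inj_eq knode_inj) xpair_eqE /=.
case: b c => -[] /=.
- by rewrite !setCS !sub1set !inE (eq_sym j) orbb andNb.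
- by rewrite C1sub1 sub1set !inE (eq_sym j).
- by rewrite C1sub1 sub1set !inE orbF.
- by rewrite !sub1set !inE (eq_sym j) orbb andNb.
Qed.

(** A common neighbour of two vertices of one side lies on the other side, at
any index different from both of theirs. *)
Lemma knode_walk2 b c (i j : 'I_n) :
  walk (knode (b, i)) (knode (c, j)) 2 = (b == c).
Proof.
rewrite walkS; apply/existsP/eqP => [[w]|<-].
  have [[d k] /eqP <-] := knode_surj w; rewrite walk1 !knode_adj.
  by case: b c d => -[] [] /=; rewrite ?andbF.
have /subsetPn[k _] : ~~ ([set: 'I_n] \subset [set i; j]).
  apply/negP => /subset_leq_card; rewrite cardsT card_ord cards2.
  by move=> /(leq_trans n_ge3); case: (_ != _).
rewrite !inE negb_or => /andP[nki nkj].
by exists (knode (~~ b, k)); rewrite walk1 !knode_adj (eq_sym i) nki nkj; case: b.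
Qed.

(** The walks of length at most 2 already separate the four types of pairs: the
antipodal pairs, on different sides with the same index, are those that no such
walk joins. *)
Lemma dist_knode b c (i j : 'I_n) (d := dist (knode (b, i)) (knode (c, j))) :
  [/\ (d == Some 0) = (b == c) && (i == j),
      (d == Some 1) = (b != c) && (i != j) &
      (d == Some 2) = (b == c) && (i != j)].
Proof.
have w0 : walk (knode (b, i)) (knode (c, j)) 0 = (b == c) && (i == j).
  by rewrite walk0 (inj_eq knode_inj) xpair_eqE.
have w1 : walk (knode (b, i)) (knode (c, j)) 1 = (b != c) && (i != j).
  by rewrite walk1 knode_adj.
have forall_iota k (P : pred nat) : [forall l : 'I_k, P l] = all P (iota 0 k).
  apply/forallP/allP => [Pk l|Pk l]; last by apply: Pk; rewrite mem_iota /=.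
  by rewrite mem_iota => lt_lk; apply: (Pk (Ordinal lt_lk)).
rewrite /d !dist_eq_some !(forall_iota _ (fun l => ~~ walk _ _ l)) /= knode_walk2 w0 w1.
by case: (b == c); case: (i == j).
Qed.

Lemma dist_knode_type b c b' c' (i j i' j' : 'I_n) :
  dist (knode (b, i)) (knode (c, j)) = dist (knode (b', i')) (knode (c', j')) ->
  (b == c) = (b' == c') /\ (i == j) = (i' == j').
Proof.
have [d0 d1 d2] := dist_knode b c i j.
have [d0' d1' d2'] := dist_knode b' c' i' j' => dE.
move: d0 d1 d2; rewrite dE d0' d1' d2'.
by case: (b == c) (i == j) (b' == c') (i' == j') => -[] [] [].
Qed.

(** On coordinates, adjacency only compares the sides and the indices for
equality, so it survives any bijection acting separately on each. *)
Lemma knode_aut (d : bool) (s : {perm 'I_n}) :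
  exists2 p : {perm H}, p \in graph_aut H &
    forall b i, p (knode (b, i)) = knode (b (+) d, s i).
Proof.
have [lab knodeK labK] := knode_bij.
pose f u := knode ((lab u).1 (+) d, s (lab u).2).
have f_inj : injective f.
  move=> u v /knode_inj[/addIb uv1 /perm_inj uv2].
  by apply: (can_inj labK); case: (lab u) (lab v) uv1 uv2 => ? ? [? ?] /= -> ->.
have fE b i : perm f_inj (knode (b, i)) = knode (b (+) d, s i).
  by rewrite permE /f knodeK.
exists (perm f_inj) => //; rewrite inE.
apply/forallP => u; apply/forallP => v.
have [[b i] /eqP <-] := knode_surj u; have [[c j] /eqP <-] := knode_surj v.
by rewrite !fE !knode_adj (inj_eq perm_inj) (inj_eq (@addIb d)).
Qed.

(** The shift of sides that is right for the first vertices is right for the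
second ones too, since two bits are determined by the first and by whether they
agree; the indices are handled by [perm_move2]. *)
Lemma pair_move b c b' c' (i j i' j' : 'I_n) :
  (b == c) = (b' == c') -> (i == j) = (i' == j') ->
  exists2 p : {perm H}, p \in graph_aut H &
    p (knode (b, i)) = knode (b', i') /\ p (knode (c, j)) = knode (c', j').
Proof.
move=> eq_bc /perm_move2[s si sj].
have [p autp pE] := knode_aut (b (+) b') s.
exists p => //; rewrite !pE si sj addKb; split=> //.
by congr (knode (_, _)); case: b c b' c' eq_bc {pE} => -[] [] [].
Qed.

End Crown.

Theorem proposition3p4 (n : nat) (hn : 3 <= n) :
  distance_transitive (bipartite_kneser n 1).
Proof.
move=> u v x y.
have [[b i] /eqP <-] := knode_surj hn u; have [[c j] /eqP <-] := knode_surj hn v.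
have [[b' i'] /eqP <-] := knode_surj hn x.
have [[c' j'] /eqP <-] := knode_surj hn y.
by move=> /(dist_knode_type hn)[]; apply: pair_move.
Qed.
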